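(* Let $\mu$ be the unique invariant measure of the period-doubling subshift. Let $m=2^k+q$ with $k\ge 0$ and $0\le q<2^k$. Denote by $r(m)$ the number of $m$-words $u$ such that $\mu([u])=2/(3\cdot 2^k)$. Then $$r(m)=\begin{cases}1 & \text{if } k=0;\\ 3\cdot 2^{k-1}-2q & \text{if } k\ge 1\text{ and } q<2^{k-1};\\ 2^k-q & \text{if } k\ge 1\text{ and } q\ge 2^{k-1}.\end{cases}$$
   Context: The period-doubling sequence $\omega=\omega_1\omega_2\ldots=0100\,0101\,0100\,0100\ldots$ is the unique fixed point in $\{0,1\}^{\mathbb{N}}$ ($\mathbb{N}=\{1,2,\dots\}$) of the substitution $0\mapsto 01$, $1\mapsto 00$; equivalently, $\omega_i=k_i\bmod 2$, where $k_i$ is the largest integer such that $2^{k_i}$ divides $i$. An $m$-word is a word of length $m$ over $\{0,1\}$. The shift is $\sigma(\alpha_1\alpha_2\alpha_3\ldots)=\alpha_2\alpha_3\ldots$ on $\{0,1\}^{\mathbb{N}}$ (product topology). The period-doubling subshift is $(X,\sigma)$, where $X$ is the closure of $\{\sigma^n(\omega):n\ge 0\}$; it is strictly ergodic (minimal and uniquely ergodic), so it has a unique $\sigma$-invariant Borel probability measure $\mu$. For an $m$-word $u=u_1\ldots u_m$, the cylinder is $[u]=\{\alpha : \alpha_j=u_j\text{ for } 1\le j\le m\}$, and $\mu([u])$ means $\mu([u]\cap X)$. *)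

(* Defs.v *)
From HB Require Import structures.
From mathcomp Require Import all_boot all_order all_algebra.
From mathcomp Require Import all_classical all_reals all_analysis.

Set Implicit Arguments.
Unset Strict Implicit.
Unset Printing Implicit Defensive.

Import Order.TTheory GRing.Theory Num.Theory.
Import numFieldNormedType.Exports.

Local Open Scope classical_set_scope.
Local Open Scope ring_scope.

(* {0,1}^N is [cantor_space] (product of discrete [bool]s), with 0 = false and
   1 = true.  Coordinates are numbered from 0: the letter written alpha_i for
   i >= 1 is [alpha i.-1]. *)

Definition cantor_shift (a : cantor_space) : cantor_space := fun i => a i.+1.

Definition pd_seq : cantor_space := fun i => odd (logn 2 i.+1).

Definition pd_block (b : bool) : seq bool :=
  if b then [:: false; false] else [:: false; true].

(* Every block has length 2, so letter i of the image of a is letter i mod 2 of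
   the block of [a i./2]. *)
Definition pd_subst (a : cantor_space) : cantor_space :=
  fun i => nth false (pd_block (a i./2)) (odd i).

Lemma pd_seq_unique_fixpoint (a : cantor_space) :
  pd_subst a = a <-> a = pd_seq.
Proof.
have fixE : pd_subst pd_seq = pd_seq.
  apply/funext => i; rewrite /pd_subst /pd_seq.
  case: (boolP (odd i)) => oi; last first.
    have -> : logn 2 i.+1 = 0%N by rewrite lognE dvdn2 /= oi.
    by case: (odd _).
  have Ei : (i.+1 = 2 * (i./2).+1)%N.
    by rewrite -[in LHS](odd_double_half i) oi mul2n doubleS.
  have -> : odd (logn 2 i.+1) = ~~ odd (logn 2 (i./2).+1).
    by rewrite [in LHS]Ei lognM// oddD (logn_prime 2 (isT : prime 2)).
  by case: (odd _).
split=> [aE|->//]; apply/funext => i.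
elim/ltn_ind: i => i IH.
rewrite -aE -fixE /pd_subst; case: (boolP (odd i)) => oi.
  rewrite IH// -divn2 ltn_Pdiv//; exact: odd_gt0.
by case: (a _); case: (pd_seq _).
Qed.

Definition pd_subshift : set cantor_space :=
  closure (range (fun n => iter n cantor_shift pd_seq)).

Lemma cantor_shift_continuous : continuous cantor_shift.
Proof.
move=> a; apply/cvg_sup => i.
apply: (@continuous_comp_initial _ cantor_space _ (fun f => f i) cantor_shift) => b.
exact: (@proj_continuous nat (fun=> bool) i.+1 b).
Qed.

Lemma pd_seq_in : pd_seq \in pd_subshift.
Proof. by rewrite inE; apply: subset_closure; exists 0%N. Qed.

Lemma pd_shift_in (x : pd_subshift) : cantor_shift (val x) \in pd_subshift.
Proof.
case: x => a /= /set_mem aX; rewrite inE => U /cantor_shift_continuous /aX [_ [[n _ <-] Un]].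
by exists (iter n.+1 cantor_shift pd_seq); split => //; exists n.+1.
Qed.

(* [set_type] carries the subspace topology. *)
Definition pd_space : Type := set_type pd_subshift.
HB.instance Definition _ := Topological.on pd_space.
HB.instance Definition _ :=
  isPointed.Build pd_space (SigSub pd_seq_in).

Definition pd_shift (x : pd_space) : pd_space := SigSub (pd_shift_in x).

Definition pd_borel := g_sigma_algebraType (@open pd_space).

Definition shift_invariant (R : realType) (mu : probability pd_borel R) :=
  forall A : set pd_borel, measurable A -> mu (pd_shift @^-1` A) = mu A.

Definition cylinder m (u : m.-tuple bool) : set cantor_space :=
  [set a | forall j : 'I_m, a j = tnth u j].

(* [u] \cap X, as a subset of X *)
Definition pd_cylinder m (u : m.-tuple bool) : set pd_borel :=
  [set x : pd_space | cylinder u (val x)].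

Definition words_of_measure (R : realType) (mu : probability pd_borel R)
    m (c : \bar R) : {set m.-tuple bool} :=
  [set u : m.-tuple bool | `[< mu (pd_cylinder u) = c >]]%SET.

(* Main.v *)
Require Import Defs.
From mathcomp Require Import all_boot all_order all_algebra.
From mathcomp Require Import all_classical all_reals all_analysis.
From mathcomp Require Import measurable_realfun zify ring lra.

(** Write [omega] for [pd_seq], and recall that [omega (2s) = 0] and
    [omega (2s+1) = 1 - omega s].

    Frequencies.  A window of [2^N] consecutive positions of [omega] contains a
    given word [u] as often as the initial window does, up to an error [size u]
    that does not depend on [N]: up to one letter in [2^N], [omega] is
    [2^N]-periodic ([pd_seq_toeplitz], [occurs_window]).  Every point of the
    subshift looks locally like [omega], so integrating the number of visits to
    the cylinder of [u] against an invariant probability gives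
    [| 2^N mu[u] - #{t < 2^N : u occurs at t} | <= size u] for all [N]
    ([freq_approx]).  This is unique ergodicity in quantitative form, and from
    there on [mu] only enters through counts of occurrences in [omega].

    Desubstitution.  A word occurring at [2s + b] is obtained from a word [y]
    occurring at [s] by interleaving zeros with the complemented letters of [y]
    ([inflate], [occurs_inflate], [occurs_desubst]).  A word of length at least
    3 determines the parity [b] of its positions ([occurs_parity]), so inflating
    halves the frequency ([freq_inflate]), and the number [nwords m w] of words
    of length [m] and frequency [w <> 0] satisfies, for [m >= 3],
    [nwords m w = nwords (floor (m/2)) (2w) + nwords (ceil (m/2)) (2w)]
    ([nwords_rec]).

    Counting.  The letters 0 and 1 have frequencies 2/3 and 1/3; the words 00, 01
    and 10 have frequency 1/3, and 11 does not occur.  The formula follows by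
    induction on [k].  For [q] maximal the recursion leaves the range
    [q < 2^k], so the induction runs over [q <= 2^k] for [k >= 1], where the formula
    remains true ([nwords_formula]). *)

Set Implicit Arguments.
Unset Strict Implicit.
Unset Printing Implicit Defensive.

(** * Occurrences of words in the period-doubling sequence *)

Lemma pd_seq_even s : pd_seq s.*2 = false.
Proof.
have [_ /(_ erefl)/(congr1 (@^~ s.*2))] := pd_seq_unique_fixpoint pd_seq.
by rewrite /pd_subst odd_double => <-; case: (pd_seq _).
Qed.

Lemma pd_seq_odd s : pd_seq s.*2.+1 = ~~ pd_seq s.
Proof.
have [_ /(_ erefl)/(congr1 (@^~ s.*2.+1))] := pd_seq_unique_fixpoint pd_seq.
by rewrite /pd_subst /= odd_double uphalf_double /= => <-; case: (pd_seq s).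
Qed.

(** By induction on [N]: even positions carry 0, and an odd position refers to a
    position half as large with modulus [2 ^ (N - 1)].  The excluded residue
    [2 ^ N - 1] is the one whose letters depend on higher powers of 2. *)
Lemma pd_seq_toeplitz N a r : r.+1 < 2 ^ N -> pd_seq (r + a * 2 ^ N) = pd_seq r.
Proof.
elim: N r => [|N IHN] r; first by rewrite expn0.
rewrite expnS; have [r' [b ->]] : exists r' (b : bool), r = b + r'.*2.
  by exists r./2, (odd r); rewrite odd_double_half.
move=> rN.
have -> : b + r'.*2 + a * (2 * 2 ^ N) = b + (r' + a * 2 ^ N).*2.
  by rewrite doubleD -addnA mulnCA mul2n.
case: b rN => rN; last by rewrite !add0n !pd_seq_even.
by rewrite !add1n !pd_seq_odd IHN //; lia.
Qed.

Definition occurs (u : seq bool) t := mkseq (fun i => pd_seq (t + i)) (size u) == u.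

Lemma occursP u t :
  reflect (forall i, i < size u -> pd_seq (t + i) = nth false u i) (occurs u t).
Proof.
apply: (iffP eqP) => [E i iu|E]; first by rewrite -[in RHS]E nth_mkseq.
apply: (@eq_from_nth _ false); rewrite size_mkseq // => i iu.
by rewrite nth_mkseq // E.
Qed.

Lemma occurs_modn N u t :
  t %% 2 ^ N + size u < 2 ^ N -> occurs u t = occurs u (t %% 2 ^ N).
Proof.
move=> tN; rewrite {1}(divn_eq t (2 ^ N)) [_ + t %% _]addnC.
by apply/occursP/occursP => E i iu; rewrite -E // addnAC pd_seq_toeplitz //; lia.
Qed.

Lemma big_nat_window (f : nat -> nat) p t0 : (forall t, f (t + p) = f t) ->
  \sum_(t0 <= t < t0 + p) f t = \sum_(0 <= t < p) f t.
Proof.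
move=> fp; elim: t0 => [|t0 IH]; first by rewrite add0n.
case: p fp IH => [|p] fp IH; first by rewrite addn0 !big_geq.
rewrite -IH addSn big_nat_recr /=; last by lia.
by rewrite [RHS]big_ltn ?fp 1?addnC //; lia.
Qed.

Definition occ_count N u := \sum_(0 <= t < 2 ^ N) occurs u t.

(** An occurrence at [t] depends only on [t] mod [2 ^ N], except for the [size u]
    residues at which the word covers the non-periodic position, and a sum of a
    periodic function over a period does not depend on the window. *)
Lemma occurs_window N u t0 :
  let S := \sum_(t0 <= t < t0 + 2 ^ N) occurs u t in
  S <= occ_count N u + size u /\ occ_count N u <= S + size u.
Proof.
set bad := fun t => 2 ^ N <= t %% 2 ^ N + size u.
have badE : \sum_(t0 <= t < t0 + 2 ^ N) bad t <= size u.
  rewrite (big_nat_window (f := fun t => bad t)); last first.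
    by move=> t; rewrite /bad modnDr.
  rewrite [X in X <= _](_ : _ = \sum_(0 <= t < 2 ^ N | 2 ^ N - size u <= t) 1).
    (* Below [2 ^ N] the bad positions are the last [size u] ones. *)
    rewrite sum1_count; have [uN|uN] := leqP (size u) (2 ^ N); last first.
      by apply: leq_trans (count_size _ _) _; rewrite size_iota subn0 ltnW.
    rewrite /index_iota subn0 -{2}(subnK uN) iotaD count_cat add0n.
    rewrite (eq_in_count (a2 := pred0)) ?count_pred0.
      by apply: leq_trans (count_size _ _) _; rewrite size_iota.
    by move=> t; rewrite mem_iota /=; lia.
  rewrite [RHS]big_mkcond; apply: eq_big_nat => t /andP[_ tN].
  rewrite /bad modn_small //.
  by have -> : (2 ^ N <= t + size u) = (2 ^ N - size u <= t) by lia.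
have CE : \sum_(t0 <= t < t0 + 2 ^ N) occurs u (t %% 2 ^ N) = occ_count N u.
  rewrite (big_nat_window (f := fun t => occurs u (t %% 2 ^ N))); last first.
    by move=> t; rewrite modnDr.
  by apply: eq_big_nat => t /andP[_ tN]; rewrite modn_small.
have E t : bad t = false -> occurs u t = occurs u (t %% 2 ^ N).
  by move/negbT; rewrite -ltnNge => /occurs_modn.
rewrite -CE; split; apply: leq_trans (leq_add (leqnn _) badE);
  rewrite -big_split leq_sum // => t _;
  by case: (bad t) (E t) => [_|->//]; case: (occurs u t); case: occurs.
Qed.

(** The pattern [0 ~y_0 0 ~y_1 ...] if [b] is false and [~y_0 0 ~y_1 0 ...] if [b]
    is true, cut at length [m]: the word of length [m] read at position [2s + b]
    when [y] is read at [s].  The number of letters of [y] that it uses is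
    [(m + b)./2]. *)
Definition inflate m (b : bool) (y : seq bool) :=
  mkseq (fun i => (odd i (+) b) && ~~ nth false y i./2) m.

Lemma nth_inflate m (b : bool) y j : j < (m + b)./2 ->
  nth false (inflate m b y) (j.*2 + ~~ b) = ~~ nth false y j.
Proof.
move=> jm; have im : j.*2 + ~~ b < m by lia.
rewrite nth_mkseq // oddD odd_double addFb oddb.
have -> : (j.*2 + ~~ b)./2 = j by lia.
by case: b {jm im}.
Qed.

Lemma inflate_inj m (b : bool) y y' : size y = (m + b)./2 -> size y' = (m + b)./2 ->
  inflate m b y = inflate m b y' -> y = y'.
Proof.
move=> sy sy' E; apply: (@eq_from_nth _ false) => [|j]; first by rewrite sy.
by rewrite sy => jm; apply: negb_inj; rewrite -!(nth_inflate _ jm) E.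
Qed.

Lemma occurs_inflate m (b : bool) y s : size y = (m + b)./2 ->
  occurs (inflate m b y) (b + s.*2) = occurs y s.
Proof.
move=> sy; apply/occursP/occursP => [E j jy|E i]; last first.
  rewrite size_mkseq => im; rewrite nth_mkseq //.
  case: (boolP (odd i (+) b)) => ib /=.
    have jy : i./2 < size y by rewrite sy; lia.
    have -> : b + s.*2 + i = (s + i./2).*2.+1 by lia.
    by rewrite pd_seq_odd E.
  have -> : b + s.*2 + i = (s + (b + i)./2).*2 by lia.
  by rewrite pd_seq_even.
have im : j.*2 + ~~ b < m by rewrite sy in jy; lia.
have := E (j.*2 + ~~ b); rewrite size_mkseq nth_inflate -?sy // => /(_ im).
have -> : b + s.*2 + (j.*2 + ~~ b) = (s + j).*2.+1 by lia.
by rewrite pd_seq_odd => /negb_inj.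
Qed.

(** Even positions carry 0, so the first and third letters are 0 by the reading at
    an even position.  In the reading at an odd position these two zeros come
    from consecutive letters 11 of [pd_seq], one of which is at an even position. *)
Lemma occurs_parity u t t' : 2 < size u -> occurs u t -> occurs u t' -> odd t = odd t'.
Proof.
move=> u3; wlog [ot ot'] : t t' / odd t = false /\ odd t' = true.
  move=> W H H'; case: (boolP (odd t)) (boolP (odd t')) => ot [] ot' //.
    by rewrite -(negbTE ot') -ot (W t' t) // (negbTE ot').
  by rewrite -(negbTE ot) -ot' (W t t') // (negbTE ot).
move=> /occursP H /occursP H'; exfalso.
have [[a aE] [a' aE']] : (exists a, t = a.*2) /\ exists a, t' = a.*2.+1.
  by split; [exists t./2; lia | exists t'./2; lia].
have E0 : pd_seq t' = false.
  by rewrite -[t']addn0 H' -?H ?aE ?addn0 ?pd_seq_even //; lia.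
have E2 : pd_seq t'.+2 = false.
  rewrite -[t'.+2]addn2 H' -?H ?aE //.
  by rewrite -[2]/(1.*2) -doubleD pd_seq_even.
move: E0 E2; rewrite aE' -doubleS !pd_seq_odd => /negbFE E0 /negbFE E1.
case: (boolP (odd a')) => oa.
  have {E1} : pd_seq (a'.+1./2).*2 by have -> : (a'.+1./2).*2 = a'.+1 by lia.
  by rewrite pd_seq_even.
have {E0} : pd_seq (a'./2).*2 by have -> : (a'./2).*2 = a' by lia.
by rewrite pd_seq_even.
Qed.

Lemma occurs_desubst u t : occurs u t -> let b := odd t in
  exists2 y, size y = (size u + b)./2 & u = inflate (size u) b y /\ occurs y t./2.
Proof.
move=> H b; have tE : t = b + (t./2).*2 by rewrite odd_double_half.
pose y := mkseq (fun i => pd_seq (t./2 + i)) (size u + b)./2.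
have sy : size y = (size u + b)./2 by rewrite size_mkseq.
have oy : occurs y t./2 by rewrite /occurs sy.
exists y => //; split => //.
move: oy; rewrite -(@occurs_inflate (size u) b) // -tE /occurs size_mkseq => /eqP <-.
by move: H; rewrite /occurs => /eqP.
Qed.

Lemma big_nat_double n (F : nat -> nat) :
  \sum_(0 <= t < n.*2) F t = \sum_(0 <= t < n) (F t.*2 + F t.*2.+1).
Proof.
elim: n => [|n IH]; first by rewrite !big_geq.
by rewrite doubleS !big_nat_recr //= IH addnA.
Qed.

(** The parity hypothesis makes [s |-> 2s + b] a bijection from the occurrences of
    [y] below [2 ^ N] onto those of the inflated word below [2 ^ N.+1]. *)
Lemma occ_count_inflate m (b : bool) y N : size y = (m + b)./2 ->
  (forall t, occurs (inflate m b y) t -> odd t = b) ->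
  occ_count N.+1 (inflate m b y) = occ_count N y.
Proof.
move=> sy par; rewrite /occ_count expnS mul2n big_nat_double.
apply: eq_bigr => s _; rewrite -(occurs_inflate s sy).
have other : occurs (inflate m b y) (~~ b + s.*2) = false.
  by apply/negP => /par; rewrite oddD odd_double oddb addbF => /esym; case: (b).
case: (b) other => other; rewrite ?add0n ?add1n /= in other *;
  by rewrite other ?addn0 ?add0n.
Qed.

(** * Frequencies of words under an invariant probability *)

Import Order.TTheory GRing.Theory Num.Theory.
Import numFieldNormedType.Exports.
Local Open Scope classical_set_scope.
Local Open Scope ring_scope.

Definition occurs_at (u : seq bool) t : set pd_borel :=
  [set x : pd_space | forall i, (i < size u)%N -> val x (t + i)%N = nth false u i].

Lemma cantor_open_agree (w : nat -> bool) t n :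
  open [set a : cantor_space | forall i, (i < n)%N -> a (t + i)%N = w i].
Proof.
elim: n => [|n IH].
  by rewrite (_ : [set _ | _] = setT) //; [exact: openT|exact/seteqP].
rewrite (_ : [set _ | _] =
    [set a : cantor_space | forall i, (i < n)%N -> a (t + i)%N = w i] `&`
    (fun a : cantor_space => a (t + n)%N) @^-1` [set w n]).
  apply: openI => //; apply: open_comp; last exact: discrete_open.
  by move=> a _; exact: (@proj_continuous nat (fun=> bool) (t + n)%N a).
apply/seteqP; split=> a /=.
  by move=> E; split=> [i iN|]; apply: E => //; lia.
move=> [E En] i; rewrite ltnS leq_eqVlt => /orP[/eqP->//|]; exact: E.
Qed.

Lemma measurable_occurs_at u t : measurable (occurs_at u t).
Proof.
apply: sub_sigma_algebra;
  exists [set a | forall i, (i < size u)%N -> a (t + i)%N = nth false u i] => //.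
exact: cantor_open_agree.
Qed.

(** The subshift is a closure, and prescribing finitely many letters is an open
    condition. *)
Lemma pd_subshift_agree (x : pd_space) n :
  exists t, forall i, (i < n)%N -> val x i = pd_seq (t + i)%N.
Proof.
have iterE t i : iter t cantor_shift pd_seq i = pd_seq (t + i)%N.
  by elim: t i => [|t IH] i //; rewrite iterS [LHS]IH addnS.
have /= := set_mem (valP x).
move=> /(_ [set a | forall i, (i < n)%N -> a (0 + i)%N = val x i]) [].
  by apply: open_nbhs_nbhs; split; [exact: cantor_open_agree|].
by move=> _ [[t _ <-] E]; exists t => i /E; rewrite iterE.
Qed.

Lemma occurs_at_agree (x : pd_space) n : exists t0, forall u t,
  (t + size u <= n)%N -> occurs_at u t x = occurs u (t0 + t)%N :> Prop.
Proof.
have [t0 E] := pd_subshift_agree x n; exists t0 => u t un; apply/propext; split.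
  by move=> H; apply/occursP => i iu; rewrite -H // E ?addnA //; lia.
by move=> /occursP H i iu; rewrite -H // E ?addnA //; lia.
Qed.

Lemma probability_occurs_at (R : realType) (mu : probability pd_borel R) u t :
  shift_invariant mu -> mu (occurs_at u t) = mu (occurs_at u 0).
Proof.
move=> inv; elim: t => [|t <-] //.
by rewrite -(inv (occurs_at u t)) //; exact: measurable_occurs_at.
Qed.

Lemma eq0_of_bounded_pow2 (R : realType) (x B : R) :
  (forall N, `|2 ^+ N * x| <= B) -> x = 0.
Proof.
move=> xB; apply/eqP/negPn/negP => x0.
have xp : 0 < `|x| by rewrite normr_gt0.
have := upper_nthrootP (leqnn (Num.bound (B / `|x|))).
rewrite ltr_pdivrMr // ltNge => /negP; apply.
by rewrite -{1}(normr_idP (exprn_ge0 _ (ler0n _ 2))) -normrM.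
Qed.

Section Frequencies.
Variables (R : realType) (mu : probability pd_borel R).
Hypothesis inv : shift_invariant mu.

Definition freq u : R := fine (mu (occurs_at u 0)).

Lemma freqE u : (freq u)%:E = mu (occurs_at u 0).
Proof. by rewrite fineK // fin_num_measure //; exact: measurable_occurs_at. Qed.

(** The Birkhoff sum of the indicator function of the cylinder of [u]. *)
Let visits u N (x : pd_borel) : R := \sum_(0 <= t < 2 ^ N) \1_(occurs_at u t) x.

Let visits_bound u N x : visits u N x <= (occ_count N u + size u)%:R /\
  (occ_count N u)%:R <= visits u N x + (size u)%:R.
Proof.
have [t0 E] := occurs_at_agree x (2 ^ N + size u).
have -> : visits u N x = (\sum_(t0 <= t < t0 + 2 ^ N) occurs u t)%:R.
  rewrite natr_sum -[X in index_iota X]add0n [(t0 + _)%N]addnC big_addn addnK.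
  apply: eq_big_nat => t /andP[_ tN]; rewrite indicE addnC; congr (nat_of_bool _)%:R.
  by apply/idP/idP; rewrite inE E //; lia.
by have [] := occurs_window N u t0; rewrite -natrD !ler_nat.
Qed.

Let visits_integral u N :
  (\int[mu]_x (visits u N x)%:E = (2 ^+ N * freq u)%:E)%E.
Proof.
under eq_integral => x _ do rewrite /visits -sumEFin.
rewrite ge0_integral_sum //; last first.
  by move=> t; apply/measurable_EFinP/measurable_indic; exact: measurable_occurs_at.
have visitE t : (\int[mu]_x (\1_(occurs_at u t) x)%:E = (freq u)%:E)%E.
  rewrite integral_indic ?setIT //; last exact: measurable_occurs_at.
  by rewrite freqE; exact: probability_occurs_at.
under eq_bigr do rewrite visitE.
by rewrite sumEFin big_const_nat subn0 iter_addr_0 -[_ *+ (2 ^ N)%N]mulr_natl natrX.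
Qed.

(** By invariance the integral of the Birkhoff sum is [2 ^+ N * freq u], while
    pointwise this sum is within [size u] of the number of occurrences in the
    initial window. *)
Lemma freq_approx u N :
  `|2 ^+ N * freq u - (occ_count N u)%:R| <= (size u)%:R.
Proof.
have mV : measurable_fun setT (EFin \o visits u N).
  apply/measurable_EFinP; rewrite /visits; apply: measurable_sum => t.
  by apply: measurable_indic; exact: measurable_occurs_at.
have V0 x : 0 <= visits u N x by apply: sumr_ge0 => t _; rewrite indicE.
have cst (c : R) : (\int[mu]_x (c%:E) = c%:E)%E.
  rewrite integral_cst // -[RHS]mule1; congr (_ * _)%E; exact: probability_setT.
have U : 2 ^+ N * freq u <= (occ_count N u + size u)%:R.
  rewrite -lee_fin -visits_integral -[X in (_ <= X)%E]cst.
  apply: ge0_le_integral => //.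
  - by move=> x _ /=; rewrite lee_fin.
  - by move=> x _ /=; rewrite lee_fin; have [] := visits_bound u N x.
have L : (occ_count N u)%:R <= 2 ^+ N * freq u + (size u)%:R.
  rewrite -lee_fin EFinD -visits_integral -[X in (_ + X)%E]cst -ge0_integralD //; last first.
    by move=> x _; rewrite lee_fin.
  rewrite -[X in (X <= _)%E]cst.
  apply: ge0_le_integral => //.
  - exact: emeasurable_funD.
  - by move=> x _ /=; rewrite -EFinD lee_fin; have [] := visits_bound u N x.
rewrite natrD in U; rewrite ler_norml; apply/andP; split; lra.
Qed.

(** The counts at levels [N.+1] and [N] agree, so [2 ^+ N] times
    [2 * freq (inflate m b y) - freq y] stays bounded. *)
Lemma freq_inflate m (b : bool) y : size y = ((m + b)./2)%N ->
  (forall t, occurs (inflate m b y) t -> odd t = b) ->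
  freq (inflate m b y) = freq y / 2.
Proof.
move=> sy par; suff: 2 * freq (inflate m b y) - freq y = 0 by lra.
apply: (@eq0_of_bounded_pow2 R _ (m + size y)%:R) => N.
have := freq_approx (inflate m b y) N.+1; have := freq_approx y N.
rewrite (occ_count_inflate N sy par) size_mkseq exprS natrD !ler_norml.
move=> /andP[? ?] /andP[? ?]; apply/andP; split; lra.
Qed.

Lemma freq_absent u : (forall t, ~~ occurs u t) -> freq u = 0.
Proof.
move=> uN; apply: (@eq0_of_bounded_pow2 R _ (size u)%:R) => N.
have := freq_approx u N; rewrite (_ : occ_count N u = 0%N) ?subr0 //.
by apply: big1 => t _; rewrite (negbTE (uN t)).
Qed.

(** Exactly one word of length [m] is read at each position. *)
Lemma sum_freq m : \sum_(u : m.-tuple bool) freq u = 1.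
Proof.
have total N : (\sum_(u : m.-tuple bool) occ_count N u = 2 ^ N)%N.
  rewrite exchange_big /= -[RHS]subn0 -[RHS]muln1 -sum_nat_const_nat.
  apply: eq_bigr => t _.
  pose w : m.-tuple bool := [tuple of mkseq (fun i => pd_seq (t + i)%N) m].
  rewrite (bigD1 w) //= big1 => [|u uw]; rewrite /occurs size_tuple ?eqxx //.
  by rewrite -[mkseq _ _]/(val w) val_eqE eq_sym (negbTE uw).
apply/eqP; rewrite -subr_eq0; apply/eqP.
apply: (@eq0_of_bounded_pow2 R _ (\sum_(u : m.-tuple bool) (size u)%:R)) => N.
have totalR : \sum_(u : m.-tuple bool) (occ_count N u)%:R = 2 ^+ N :> R.
  by rewrite -natr_sum total natrX.
rewrite mulrBr mulr1 mulr_sumr -[X in _ - X]totalR -sumrB.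
by apply: le_trans (ler_norm_sum _ _ _) _; apply: ler_sum => u _; exact: freq_approx.
Qed.

(** * Counting words of given frequency *)

Definition nwords m (w : R) := #|[set u : m.-tuple bool | freq u == w]%SET|.

Definition inflate_tuple m b n (y : n.-tuple bool) : m.-tuple bool :=
  [tuple of inflate m b y].

(** The words of length [m] and frequency [w] are the inflations, with either
    phase [b], of the words of frequency [2 * w]; the two families are disjoint
    because a word of length at least 3 has a single phase.  The hypothesis
    [w != 0] ensures that all the words involved occur in [pd_seq], without which
    inflating need not halve frequencies: 000 is the inflation of 11. *)
Lemma nwords_rec m (w : R) : (2 < m)%N -> w != 0 ->
  nwords m w = (nwords m./2 (2 * w) + nwords (uphalf m) (2 * w))%N.
Proof.
move=> m3 w0.
have present n (u : n.-tuple bool) (c : R) : c != 0 -> freq u = c -> exists t, occurs u t.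
  move=> c0 uc; apply: contrapT => uN; move/eqP: c0; apply; rewrite -uc.
  by apply: freq_absent => t; apply/negP => ut; apply: uN; exists t.
have w20 : 2 * w != 0 by rewrite mulf_neq0 // pnatr_eq0.
pose F (b : bool) : {set m.-tuple bool} :=
  (@inflate_tuple m b _ @:
     [set y : ((m + b)./2)%N.-tuple bool | freq y == 2 * w]%SET)%SET.
have par (b : bool) (y : ((m + b)./2)%N.-tuple bool) s :
    occurs y s -> occurs (inflate m b y) (b + s.*2)%N.
  by rewrite occurs_inflate ?size_tuple.
have cF b : #|F b| = nwords (m + b)./2%N (2 * w).
  apply: card_imset => y y' /(congr1 val) /= E; apply: val_inj.
  by apply: inflate_inj E; rewrite size_tuple.
have -> : uphalf m = ((m + true)./2)%N by lia.
have -> : m./2 = ((m + false)./2)%N by lia.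
rewrite -!cF -cardsUI.
have -> : F false :&: F true = finset.set0.
  apply/setP => u; rewrite !inE; apply/negP => /andP[].
  move=> /imsetP[y + ->]; rewrite inE => /eqP/(present _ _ _ w20) [s ys].
  move=> /imsetP[y' + /(congr1 val) /= E]; rewrite inE => /eqP/(present _ _ _ w20) [s' ys'].
  have := par _ _ _ ys'; rewrite -E => H'.
  have := occurs_parity _ (par _ _ _ ys) H'; rewrite size_mkseq => /(_ m3).
  by rewrite !oddD !odd_double.
rewrite cards0 addn0; apply: eq_card => u; rewrite !inE.
have desc (b : bool) (y : ((m + b)./2)%N.-tuple bool) s : occurs y s ->
    freq (inflate m b y) = freq y / 2.
  move=> ys; apply: freq_inflate => [|t H]; first by rewrite size_tuple.
  rewrite (occurs_parity _ H (par _ _ _ ys)) ?size_mkseq //.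
  by rewrite oddD odd_double oddb addbF.
apply/eqP/idP => [uw|uF].
  have [t ut] := present _ _ _ w0 uw.
  have [y] := occurs_desubst ut; rewrite size_tuple => sy [uE yt].
  have : u \in F (odd t).
    apply/imsetP; exists (Tuple (introT eqP sy)); last by apply: val_inj.
    rewrite inE /= -uw uE (desc _ (Tuple (introT eqP sy)) t./2) //=.
    by apply/eqP; field.
  by case: (odd t) => ->; rewrite ?orbT.
have {uF} [b /imsetP[y + ->]] : exists b, u \in F b.
  by case/orP: uF; [exists false|exists true].
rewrite inE => /eqP yw; have [s ys] := present _ _ _ w20 yw.
by rewrite /= (desc _ _ _ ys) yw; field.
Qed.

(** The letter 1 is found at odd positions only, so it is the unambiguous
    inflation of the letter 0 and has half its frequency. *)
Lemma freq_letter b : freq [:: b] = if b then 3^-1 else 2 / 3.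
Proof.
have S : freq [:: false] + freq [:: true] = 1.
  rewrite -(sum_freq 1) (bigD1 [tuple false]) //= (bigD1 [tuple true]) //= big1 ?addr0 //.
  by case/tupleP => -[] u; rewrite (tuple0 u).
have H : freq [:: true] = freq [:: false] / 2.
  apply: (@freq_inflate 1 true [:: false]) => // t /occursP /(_ 0%N isT) /=.
  by rewrite addn0 -{1}[t]odd_double_half; case: (odd t); rewrite ?add0n ?pd_seq_even.
by case: b; lra.
Qed.

(** The words 01 and 10 contain a 1, which fixes the parity of their positions:
    each is an unambiguous inflation of the letter 0. *)
Lemma freq_pair a b : freq [:: a; b] = if a && b then 0 else 3^-1.
Proof.
have F10 : freq [:: true; false] = 3^-1.
  have -> : 3^-1 = freq [:: false] / 2 by rewrite freq_letter; lra.
  apply: (@freq_inflate 2 true [:: false]) => // t /occursP /(_ 0%N isT) /=.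
  by rewrite addn0 -{1}[t]odd_double_half; case: (odd t); rewrite ?add0n ?pd_seq_even.
have F01 : freq [:: false; true] = 3^-1.
  have -> : 3^-1 = freq [:: false] / 2 by rewrite freq_letter; lra.
  apply: (@freq_inflate 2 false [:: false]) => // t /occursP /(_ 1%N isT) /=.
  rewrite addn1 -{1}[t]odd_double_half; case: (odd t) => //.
  by rewrite add1n -doubleS pd_seq_even.
have F11 : freq [:: true; true] = 0.
  apply: freq_absent => t; apply/negP => /occursP H.
  have := H 0%N isT; have := H 1%N isT; rewrite /= addn0 addn1.
  rewrite -[t]odd_double_half; case: (odd t); last by rewrite pd_seq_even.
  by rewrite add1n -doubleS pd_seq_even.
have S := sum_freq 2.
rewrite (bigD1 [tuple false; false]) //= (bigD1 [tuple false; true]) //= in S.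
rewrite (bigD1 [tuple true; false]) //= (bigD1 [tuple true; true]) //= big1 in S; last first.
  by case/tupleP => -[] /tupleP [[] u]; rewrite (tuple0 u).
by case: a; case: b => //=; lra.
Qed.

Lemma nwords1 : nwords 1 (2 / 3) = 1%N.
Proof.
rewrite -[RHS](cards1 [tuple false]); apply: eq_card => u.
rewrite !inE; case/tupleP: u => a u; rewrite (tuple0 u) freq_letter.
case: a; last by rewrite !eqxx.
by apply/negbTE/eqP; lra.
Qed.

Lemma nwords2 : nwords 2 3^-1 = 3%N.
Proof.
transitivity #|[set~ [tuple true; true]]%SET|; last first.
  by rewrite cardsC1 card_tuple card_bool.
apply: eq_card => u.
rewrite !inE; case/tupleP: u => a u; case/tupleP: u => b u; rewrite (tuple0 u).
rewrite -val_eqE freq_pair /=.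
case: a; case: b; rewrite /= ?eqxx //.
by apply/negbTE/eqP; lra.
Qed.

Lemma nwords2_0 : nwords 2 (2 / 3) = 0%N.
Proof.
apply/eqP; rewrite cards_eq0; apply/eqP/setP => u; rewrite !inE.
case/tupleP: u => a u; case/tupleP: u => b u; rewrite (tuple0 u) freq_pair.
by apply/negbTE/eqP; case: (a && b); lra.
Qed.

(** For [k = 0] the cases [q = 1] and [q = 2] come from the recursion, but [q = 0]
    does not: the word 00 of length 2 is an inflation with either phase.  In the
    inductive step the two branches are linear in [q] and agree at
    [q = 2 ^ k], which makes them compatible with splitting [q] into
    [q./2 + uphalf q]. *)
Lemma nwords_formula k q : (q <= 2 ^ k.+1)%N ->
  nwords (2 ^ k.+1 + q) (2 / (3 * 2 ^+ k.+1)) =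
  (if q < 2 ^ k then 3 * 2 ^ k - 2 * q else 2 ^ k.+1 - q)%N.
Proof.
elim: k q => [|k IH] q qk.
  have -> : 2 / (3 * 2 ^+ 1) = 3^-1 :> R by rewrite expr1; field.
  have E : 2 / 3%:R = 2 * 3^-1 :> R by [].
  have w0 : 3^-1 != 0 :> R by rewrite invr_eq0 pnatr_eq0.
  case: q qk => [|[|[|//]]] _.
  - exact: nwords2.
  - by rewrite nwords_rec // -E /= nwords1 nwords2_0.
  - by rewrite nwords_rec // -E /= nwords2_0.
have P : (0 < 2 ^ k)%N by rewrite expn_gt0.
have E2 : (2 ^ k.+2 = 2 * 2 ^ k.+1)%N by rewrite expnS.
have E1 : (2 ^ k.+1 = 2 * 2 ^ k)%N by rewrite expnS.
rewrite nwords_rec; first last.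
- by rewrite mulf_neq0 // ?invr_eq0 ?mulf_neq0 ?expf_neq0 ?pnatr_eq0.
- by lia.
have -> : 2 * (2 / (3 * 2 ^+ k.+2)) = 2 / (3 * 2 ^+ k.+1) :> R.
  by rewrite [in LHS]exprS; field; rewrite expf_neq0 // pnatr_eq0.
have -> : ((2 ^ k.+2 + q)./2 = 2 ^ k.+1 + q./2)%N by lia.
have -> : (uphalf (2 ^ k.+2 + q) = 2 ^ k.+1 + uphalf q)%N by lia.
rewrite !IH; [|lia|lia].
by case: (ltnP q (2 ^ k.+1)); case: (ltnP q./2 (2 ^ k));
  case: (ltnP (uphalf q) (2 ^ k)); lia.
Qed.

Lemma words_of_measureE m (c : R) : #|words_of_measure mu m c%:E| = nwords m c.
Proof.
apply: eq_card => u; rewrite !inE.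
have -> : pd_cylinder u = occurs_at u 0.
  apply/seteqP; split=> x H i.
    by rewrite size_tuple => im; rewrite add0n (H (Ordinal im)) (tnth_nth false).
  by rewrite (tnth_nth false) -H ?size_tuple.
by rewrite -freqE; apply/asboolP/eqP => [[]|->].
Qed.

End Frequencies.

Theorem corollary1p3 (R : realType) (mu : probability pd_borel R)
    (mu_inv : shift_invariant mu) (m k q : nat)
    (mE : m = (2 ^ k + q)%N) (q_lt : (q < 2 ^ k)%N) :
  #|words_of_measure mu m (2 / (3 * 2 ^+ k))%:E| =
    (if k == 0 then 1
     else if q < 2 ^ (k - 1) then 3 * 2 ^ (k - 1) - 2 * q
     else 2 ^ k - q)%N.
Proof.
rewrite words_of_measureE mE; case: k q_lt {mE} => [|k] qk /=.
  by case: q qk => // _; rewrite expr0 mulr1 nwords1.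
by rewrite nwords_formula ?subn1 // ltnW.
Qed.
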